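(* Let $\{b_n : n\ge 1\}$ be the partial quotient sequence of the Engel continued fraction (ECF) expansion, regarded as a sequence of random variables on $(0,1]$ with Lebesgue measure $\mathbf{P}$. Then for all integers $k\ge j\ge1$, $$\mathbf{P}(b_1=j)=\frac{1}{j(j+1)}$$ and $$\frac{j}{k(k+2)}\le\mathbf{P}(b_{n+1}=k\mid b_n=j)\le\frac{j+1}{k(k+1)}\qquad\text{for all } n\ge1.$$
   Context: Probability space: $\Omega=(0,1]$ with its Borel $\sigma$-algebra and $\mathbf{P}$ = Lebesgue measure. ECF map: $T_E x=\frac{1}{[1/x]}\left(\frac1x-\left[\frac1x\right]\right)$, where $[\cdot]$ is the integer part. Partial quotients: $b_1(x)=[1/x]$ and $b_{n+1}(x)=b_1(T_E^n x)$ for $n\ge1$. For every irrational $x\in(0,1)$ all iterates $T_E^n x$ are irrational numbers in $(0,1)$, so all $b_n(x)$ are defined; thus the $b_n$ are defined $\mathbf{P}$-almost everywhere, take values in the positive integers, and satisfy $b_{n+1}\ge b_n$. *)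

(* Defs.v *)
From HB Require Import structures.
From mathcomp Require Import all_boot all_order all_algebra.
From mathcomp Require Import all_classical all_reals all_analysis.
From mathcomp Require Import measurable_realfun.

Set Implicit Arguments.
Unset Strict Implicit.
Unset Printing Implicit Defensive.

Import Order.TTheory GRing.Theory Num.Theory.
Import numFieldNormedType.Exports.

Local Open Scope classical_set_scope.
Local Open Scope ring_scope.

(* Total: 0 when P B = 0, since division by zero is 0. *)
Definition cond_prob (d : measure_display) (T : measurableType d)
    (R : realType) (P : probability T R) (A B : set T) : R :=
  fine (P (A `&` B)) / fine (P B).

(* The sample space (0, 1] with its Borel sets and Lebesgue measure is encoded
   as the Borel line carrying the probability A |-> |A `&` ]0, 1]|. *)
Definition leb01 (R : realType) : set (measurableTypeR R) -> \bar R :=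
  mrestr (@lebesgue_measure R) (measurable_itv `]0, 1]).

HB.instance Definition _ (R : realType) := Measure.on (@leb01 R).

Lemma leb01_setT (R : realType) : leb01 [set: measurableTypeR R] = 1%:E.
Proof.
by rewrite /leb01 /mrestr setTI lebesgue_measure_itv/= lte_fin ltr01 sube0.
Qed.

HB.instance Definition _ (R : realType) :=
  Measure_isProbability.Build _ _ _ (@leb01 R) (@leb01_setT R).

(* Engel continued fractions. [Num.truncn] is the integer part on x >= 0.  As
   0^-1 = 0, the maps below are total and 0 is a fixed point of the ECF map;
   after a (rational) orbit hits 0 all further digits are 0, which is not a
   value of any partial quotient. *)
Definition ecf_digit1 (R : realType) (x : R) : nat := Num.truncn (1 / x).

Definition ecf_map (R : realType) (x : R) : R :=
  1 / (ecf_digit1 x)%:R * (1 / x - (ecf_digit1 x)%:R).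

(* Digits are numbered from 1; the value at n = 0 is junk. *)
Definition ecf_digit (R : realType) (n : nat) (x : measurableTypeR R) : nat :=
  ecf_digit1 (iter n.-1 (@ecf_map R) x).

Lemma measurable_invr (R : realType) :
  measurable_fun setT (fun x : R => x^-1).
Proof.
rewrite -(setUv [set (0 : R)]); apply/measurable_funU => //.
  exact: measurableC.
split; first exact: measurable_fun_set1.
apply: open_continuous_measurable_fun.
  by apply: closed_openC; rewrite -set_itv1; exact: interval_closed.
move=> x; rewrite inE/= => /eqP x0; exact: inv_continuous.
Qed.

Lemma measurable_truncn (R : realType) :
  measurable_fun setT (@Num.truncn R).
Proof.
move=> _ Y _; rewrite setTI.
rewrite (_ : _ @^-1` Y = \bigcup_(n in Y) [set x : R | Num.truncn x = n]).
  apply: bigcup_measurable => -[|n] _.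
    rewrite (_ : [set x | _] = `]-oo, 1[%classic); first exact: measurable_itv.
    by apply/seteqP; split=> x /=;
      rewrite in_itv/= ltNge => /truncn0Pn.
  rewrite (_ : [set x | _] = `[n.+1%:R, n.+2%:R[%classic).
    exact: measurable_itv.
  apply/seteqP; split=> x /=; rewrite in_itv/=; last exact: truncn_def.
  move=> xn; rewrite -xn truncnS_gt truncn_le andbT.
  by apply: (le_trans ler01); rewrite -truncn_gt0 xn.
apply/seteqP; split=> [x Yx|x [n Yn xn]]; first by exists (Num.truncn x).
by rewrite /preimage/= xn.
Qed.

Lemma measurable_ecf_digit1 (R : realType) :
  measurable_fun setT (@ecf_digit1 R).
Proof.
apply: (measurableT_comp (@measurable_truncn R)).
under eq_fun do rewrite div1r.
exact: measurable_invr.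
Qed.

Lemma measurable_ecf_map (R : realType) : measurable_fun setT (@ecf_map R).
Proof.
have mr : measurable_fun setT
   (fun x : R => (ecf_digit1 x)%:R : R).
  have mn : measurable_fun [set: nat] (fun n => n%:R : R) by [].
  exact: (measurableT_comp mn (@measurable_ecf_digit1 R)).
apply: measurable_funM.
  under eq_fun do rewrite div1r.
  exact: (measurableT_comp (@measurable_invr R) mr).
apply: measurable_funB => //.
under eq_fun do rewrite div1r.
exact: measurable_invr.
Qed.

Lemma measurable_ecf_digit (R : realType) (n : nat) :
  measurable_fun [set: measurableTypeR R] (@ecf_digit R n).
Proof.
apply: (measurableT_comp (@measurable_ecf_digit1 R)).
elim: n.-1 => [|m IHm]; first exact: measurable_id.
exact: (measurableT_comp (@measurable_ecf_map R) IHm).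
Qed.

HB.instance Definition _ (R : realType) (n : nat) :=
  isMeasurableFun.Build _ _ (measurableTypeR R) nat
    (@ecf_digit R n) (@measurable_ecf_digit R n).

(* Main.v *)
Require Import Defs.
From mathcomp Require Import all_boot all_order all_algebra.
From mathcomp Require Import all_classical all_reals all_analysis.
From mathcomp Require Import ring lra.

Set Implicit Arguments.
Unset Strict Implicit.
Unset Printing Implicit Defensive.

Import Order.TTheory GRing.Theory Num.Theory.

Local Open Scope classical_set_scope.
Local Open Scope ring_scope.

(** Write T for the ECF map.  The set of points with prescribed digits
    b_1, ..., b_l, the last one being m, is an interval which T^l maps onto
    [0, 1/m[ up to endpoints, and the inverse of T^l on it is a Moebius map.
    After normalisation this inverse is t |-> a + g / (c + t); prescribing one
    more digit i replaces c by 1 + 1 / (c i), and c = 1 for l = 1, so that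
    c >= 1 throughout ([ecf_branch1], [ecf_branchS]).

    Inside such a branch of rank n with last digit j, the event b_(n+1) = k is
    the event that T^n x lies in ]1/(k+1), 1/k].  The length of the image of an
    interval ]u, v[ under t |-> a + g / (c + t) being
    |g| (v - u) / ((c + u) (c + v)) ([leb01_branch]), the proportion of the
    branch occupied by this event is, with r = 1 / c in [0, 1],
      (j + r) / ((k + r) (k + 1 + r)),
    which lies between the two announced bounds because 0 <= r <= 1 and j <= k
    ([branch_ratio_bounds]).

    The event b_n = j is a disjoint union of branches of rank n with last digit
    j, so the bounds on each branch add up to bounds on the whole event
    ([ecf_branch_le]).  Instead of enumerating the branches, the inequality is
    propagated backwards from rank n to rank 1 by splitting, at each rank,
    according to the value of the next digit.  Finally b_n = j has positive
    probability, since it contains the branch with digits j, ..., j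
    ([leb01_digit_gt0]): the conditional probability is a genuine quotient.
    The law of b_1 is the length of a branch of rank 1. *)

(** * Lengths of images of intervals under Moebius maps *)

(** Endpoints are left free because the inverse branches alternately preserve
    and reverse the orientation, which exchanges open and closed ends. *)
Lemma lebesgue_measure_between (R : realType) (p q : R)
    (S : set (measurableTypeR R)) : measurable S -> p <= q ->
  `]p, q[ `<=` S -> S `<=` `[p, q] ->
  lebesgue_measure S = (q - p)%:E.
Proof.
move=> mS pq lo hi.
have itvE b1 b2 : lebesgue_measure
    ([set` Interval (BSide b1 p) (BSide b2 q)] : set R) = (q - p)%:E.
  rewrite lebesgue_measure_itv/= lte_fin; case: ltgtP pq => // -> _.
  by rewrite subrr.
apply/eqP; rewrite eq_le; apply/andP; split.
  rewrite -(itvE true false).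
  by apply: le_measure => //; rewrite inE//; exact: measurable_itv.
rewrite -(itvE false true).
by apply: le_measure => //; rewrite inE//; exact: measurable_itv.
Qed.

Lemma ltr_div_swap (R : realFieldType) (g p q y : R) :
  0 < g -> 0 < p -> 0 < q -> g / q < y < g / p -> p < g / y < q.
Proof.
move=> g0 p0 q0 /andP[qy yp].
have y0 : 0 < y by apply: lt_trans qy; exact: divr_gt0.
move: qy yp; rewrite !(ltr_pdivrMr, ltr_pdivlMr)// => qy yp.
by rewrite mulrC yp mulrC.
Qed.

(** On positive reals s |-> a + g / s is strictly monotone, in a direction given
    by the sign of g, so [S] is an interval with ends a + g / p and a + g / q
    in one order or the other. *)
Lemma lebesgue_measure_inversion (R : realType) (a g p q : R)
    (S : set (measurableTypeR R)) : measurable S -> g != 0 ->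
  0 < p -> p <= q ->
  (forall s, p < s < q -> S (a + g / s)) ->
  (forall x, S x -> exists2 s, p <= s <= q & x = a + g / s) ->
  lebesgue_measure S = (`|g| * (q - p) / (p * q))%:E.
Proof.
move=> mS g0 p0 pq lo hi; have q0 : 0 < q by exact: lt_le_trans pq.
have onto x : x != a -> p < g / (x - a) < q -> S x.
  move=> xa /lo; rewrite (_ : a + _ = x)//.
  by field; rewrite subr_eq0 xa g0.
have [gneg|gpos|g00] := ltgtP g 0; last by rewrite g00 eqxx in g0.
- rewrite (@lebesgue_measure_between _ (a + g / p) (a + g / q) S)//.
  + by rewrite ltr0_norm//; congr (_%:E); field; rewrite !gt_eqF.
  + by rewrite lerD2l ler_nM2l// lef_pV2.
  + move=> x /=; rewrite in_itv/= => /andP[px xq].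
    have xa : x < a.
      by apply: lt_le_trans xq _; rewrite gerDl pmulr_lle0 ?invr_gt0// ltW.
    apply: onto; first by rewrite lt_eqF.
    rewrite -mulrNN -invrN; apply: ltr_div_swap; rewrite ?oppr_gt0//.
    by rewrite !mulNr; lra.
  + move=> x /hi[s /andP[ps sq] ->] /=; have s0 := lt_le_trans p0 ps.
    by rewrite in_itv/= !lerD2l !ler_nM2l// !lef_pV2// ps sq.
- rewrite (@lebesgue_measure_between _ (a + g / q) (a + g / p) S)//.
  + by rewrite gtr0_norm//; congr (_%:E); field; rewrite !gt_eqF.
  + by rewrite lerD2l ler_pM2l// lef_pV2.
  + move=> x /=; rewrite in_itv/= => /andP[px xq].
    have xa : a < x.
      by apply: le_lt_trans px; rewrite lerDl divr_ge0// ltW.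
    apply: onto; first by rewrite gt_eqF.
    by apply: ltr_div_swap => //; lra.
  + move=> x /hi[s /andP[ps sq] ->] /=; have s0 := lt_le_trans p0 ps.
    by rewrite in_itv/= !lerD2l !ler_pM2l// !lef_pV2// ps sq.
Qed.

(** * Comparing measures piece by piece *)

Lemma measure_partition_le d (T : measurableType d) (R : realType)
    (mu : {measure set T -> \bar R}) (f : T -> nat) (A B : set T) (r s : R) :
  measurable_fun setT f -> measurable A -> measurable B ->
  0 <= r -> 0 <= s ->
  (forall i, (r%:E * mu (A `&` [set x | f x = i])
              <= s%:E * mu (B `&` [set x | f x = i]))%E) ->
  (r%:E * mu A <= s%:E * mu B)%E.
Proof.
move=> mf mA mB r0 s0 le_i.
have mfi i : measurable [set x | f x = i].
  by rewrite -[X in measurable X]setTI; exact: (mf measurableT [set i]).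
have muE C : measurable C ->
    mu C = (\big[+%E/0]_(0 <= i <oo) mu (C `&` [set x | f x = i]))%E.
  move=> mC; rewrite -measure_semi_bigcup.
  - congr (mu _); apply/seteqP; split=> [x Cx|x [i _ []]//].
    by exists (f x).
  - by move=> i; exact: measurableI.
  - exact: trivIset_preimage1_in.
  - by apply: bigcup_measurable => i _; exact: measurableI.
rewrite (muE A mA) (muE B mB) -!nneseriesZl//.
apply: lee_nneseries => [i _ _|i _]; last exact: le_i.
by rewrite mule_ge0.
Qed.

Lemma cond_prob_bounds (d : measure_display) (T : measurableType d)
    (R : realType) (P : probability T R) (A B : set T) (r s : R) :
  measurable A -> measurable B -> (0 < P B)%E ->
  (r%:E * P B <= P (A `&` B))%E -> (P (A `&` B) <= s%:E * P B)%E ->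
  r <= cond_prob P A B <= s.
Proof.
move=> mA mB.
have fP C : measurable C -> P C \is a fin_num by move=> mC; exact: fin_num_measure.
rewrite /cond_prob -(fineK (fP _ mB)) -(fineK (fP _ (measurableI _ _ mA mB))).
rewrite -!EFinM !lte_fin !lee_fin/= => PB0 lo hi.
by rewrite ler_pdivlMr// ler_pdivrMr// lo hi.
Qed.

(** * One step of the ECF map *)

Lemma ecf_digit1P (R : realType) (i : nat) (x : R) : (0 < i)%N ->
  ecf_digit1 x = i <-> i.+1%:R^-1 < x <= i%:R^-1.
Proof.
move=> i0; have i0R : 0 < i%:R :> R by rewrite ltr0n.
have i1R : 0 < i.+1%:R :> R by rewrite ltr0n.
have digE : 0 < x ->
    (i%:R <= x^-1 < i.+1%:R) = (i.+1%:R^-1 < x <= i%:R^-1).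
  by move=> x0; rewrite andbC invf_plt// invf_pge.
rewrite /ecf_digit1 div1r; split=> [xi|x1].
  have x1 : 1 <= x^-1 by rewrite -truncn_gt0 xi.
  have x0 : 0 < x by rewrite -invr_gt0 (lt_le_trans ltr01).
  by rewrite -digE// -{1 2}xi truncn_itv// invr_ge0 ltW.
have x0 : 0 < x by case/andP: x1 => x1 _; apply: lt_trans x1; rewrite invr_gt0.
by apply: truncn_def; rewrite digE.
Qed.

Lemma ecf_map_digit (R : realType) (i : nat) (x : R) : (0 < i)%N ->
  ecf_digit1 x = i ->
  0 <= ecf_map x < i%:R^-1 /\ x = (i%:R * (1 + ecf_map x))^-1.
Proof.
move=> i0 xi; have i0R : 0 < i%:R :> R by rewrite ltr0n.
have /andP[x1 x2] := (ecf_digit1P x i0).1 xi.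
have i1R : 0 < i.+1%:R :> R by rewrite ltr0n.
have x0 : 0 < x by apply: lt_trans x1; rewrite invr_gt0.
rewrite /ecf_map xi !div1r; split; last first.
  field; rewrite (gt_eqF x0) (gt_eqF i0R)/=.
  by rewrite (_ : _ + _ = 1) ?oner_neq0//; ring.
apply/andP; split.
  by rewrite mulr_ge0 ?invr_ge0 ?(ltW i0R)// subr_ge0 invf_pge.
rewrite gtr_pMr ?invr_gt0// ltrBlDr.
by move: x1; rewrite invf_plt// -natr1 addrC.
Qed.

(** Converse of [ecf_map_digit]: s |-> 1 / (i (1 + s)) is the inverse of the ECF
    map on the points with first digit i. *)
Lemma ecf_map_branch (R : realType) (i : nat) (s : R) : (0 < i)%N ->
  0 <= s < i%:R^-1 ->
  ecf_digit1 (i%:R * (1 + s))^-1 = i /\ ecf_map (i%:R * (1 + s))^-1 = s.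
Proof.
move=> i0 /andP[s0 si]; have i0R : 0 < i%:R :> R by rewrite ltr0n.
have s1 : 0 < 1 + s by rewrite ltr_wpDr.
have is1 : i%:R * s < 1 by rewrite mulrC -ltr_pdivlMr// div1r.
have digE : ecf_digit1 (i%:R * (1 + s))^-1 = i.
  apply/(ecf_digit1P _ i0).
  rewrite ltf_pV2 ?lef_pV2 ?posrE ?mulr_gt0// -natr1.
  by rewrite mulrDr mulr1 ltrD2l is1/= lerDl mulr_ge0// ltW.
split=> //; rewrite /ecf_map digE; field.
by rewrite !gt_eqF.
Qed.

(** * Branches of the iterates of the ECF map *)

(** [W] stands for the set of points with l prescribed first digits, m being the
    last one, and t |-> a + g / (c + t) for the inverse of T^l on [W].  The two
    directions of the bijection differ at t = 0: for l > 1, a point whose orbit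
    reaches 0 in l steps passes through 1 / m one step before, a value which
    the previous branch misses when its last digit is m as well.  Requiring
    only the open interval to be covered makes the notion stable under
    refinement, and loses only a null set. *)
Record ecf_branch (R : realType) (l m : nat) (W : set (measurableTypeR R))
    (a g c : R) : Prop := EcfBranch {
  branch_measurable : measurable W;
  branch_sub01 : W `<=` `]0, 1];
  branch_neq0 : g != 0;
  branch_ge1 : 1 <= c;
  branch_digit : forall x, W x -> ecf_digit l x = m;
  branch_orbit : forall x, W x -> 0 <= iter l (@ecf_map R) x < m%:R^-1;
  branch_inv : forall x, W x -> x = a + g / (c + iter l (@ecf_map R) x);
  branch_mem : forall t : R, 0 < t < m%:R^-1 -> W (a + g / (c + t));
  branch_iter : forall t : R, 0 < t < m%:R^-1 ->
    iter l (@ecf_map R) (a + g / (c + t)) = t }.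

Lemma leb01_sub (R : realType) (A : set (measurableTypeR R)) :
  A `<=` `]0, 1] -> leb01 A = lebesgue_measure A.
Proof. by move=> A01; rewrite /leb01 /mrestr setIidl. Qed.

(** The two conditions on [V] say that it is the part of the branch where
    T^l x lies between u and v, with arbitrary endpoints. *)
Lemma leb01_branch (R : realType) (l m : nat) (W V : set (measurableTypeR R))
    (a g c u v : R) : ecf_branch l m W a g c -> 0 <= u -> u <= v ->
  v <= m%:R^-1 -> measurable V -> V `<=` W ->
  (forall x, W x -> u < iter l (@ecf_map R) x < v -> V x) ->
  (forall x, V x -> u <= iter l (@ecf_map R) x <= v) ->
  leb01 V = (`|g| * (v - u) / ((c + u) * (c + v)))%:E.
Proof.
move=> [mW W01 g0 c1 _ _ xW WE iterE] u0 uv vm mV VW lo hi.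
rewrite leb01_sub; last exact: subset_trans VW W01.
have -> : v - u = (c + v) - (c + u) by ring.
have c0 : 0 < c by exact: lt_le_trans c1.
apply: (@lebesgue_measure_inversion _ a) => //.
- by rewrite ltr_wpDr.
- by rewrite lerD2l.
- move=> s /andP[us sv].
  have tm : 0 < s - c < m%:R^-1 by apply/andP; split; lra.
  have -> : s = c + (s - c) by ring.
  by apply: lo; rewrite ?iterE//; [exact: WE | apply/andP; split; lra].
- move=> x Vx; exists (c + iter l (@ecf_map R) x); last exact/xW/VW.
  by rewrite !lerD2l; exact: hi.
Qed.

Lemma leb01_branchT (R : realType) (l m : nat) (W : set (measurableTypeR R))
    (a g c : R) : ecf_branch l m W a g c ->
  leb01 W = (`|g| * (m%:R^-1 / (c * (c + m%:R^-1))))%:E.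
Proof.
move=> Wb; have mW := branch_measurable Wb.
have mV0 : 0 <= m%:R^-1 :> R by rewrite invr_ge0.
rewrite (leb01_branch Wb (lexx 0) mV0 (lexx _) mW)//.
- by rewrite subr0 addr0 mulrA.
- by move=> x /(branch_orbit Wb)/andP[-> /ltW].
Qed.

Lemma measurable_ecf_digit_eq (R : realType) (n i : nat) :
  measurable [set x : measurableTypeR R | ecf_digit n x = i].
Proof.
rewrite -[X in measurable X]setTI.
exact: (@measurable_ecf_digit R n measurableT [set i]).
Qed.

Lemma ecf_branch1 (R : realType) (i : nat) : (0 < i)%N ->
  ecf_branch 1 i [set x : measurableTypeR R | ecf_digit 1 x = i] 0 i%:R^-1 1.
Proof.
move=> i0; have i0R : 0 < i%:R :> R by rewrite ltr0n.
have invE (s : R) : 0 + i%:R^-1 / (1 + s) = (i%:R * (1 + s))^-1.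
  by rewrite add0r invfM.
split; rewrite ?invr_neq0 ?(gt_eqF i0R)//.
- exact: measurable_ecf_digit_eq.
- move=> x /(ecf_digit1P _ i0)/andP[x1 x2] /=; rewrite in_itv/=.
  apply/andP; split; first by apply: lt_trans x1; rewrite invr_gt0.
  by apply: le_trans x2 _; rewrite invf_le1// ler1n.
- by move=> x /(ecf_map_digit i0)[].
- by move=> x /(ecf_map_digit i0)[_]; rewrite invE.
- move=> t /andP[t0 ti]; rewrite invE.
  by have [] := @ecf_map_branch _ i t i0; rewrite ?(ltW t0).
- move=> t /andP[t0 ti]; rewrite invE.
  by have [] := @ecf_map_branch _ i t i0; rewrite ?(ltW t0).
Qed.

(** The new parameters come from substituting t = 1 / (i (1 + s)) in
    a + g / (c + t).  Since digits never decrease, only i >= m occurs. *)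
Lemma ecf_branchS (R : realType) (l m i : nat) (W : set (measurableTypeR R))
    (a g c : R) : (0 < m)%N -> (m <= i)%N -> ecf_branch l m W a g c ->
  ecf_branch l.+1 i (W `&` [set x | ecf_digit l.+1 x = i])
    (a + g / c) (- (g / (c ^+ 2 * i%:R))) (1 + (c * i%:R)^-1).
Proof.
move=> m0 mi [mW W01 g0 c1 _ Worb xW WE iterE].
have i0 : (0 < i)%N by exact: leq_trans mi.
have i0R : 0 < i%:R :> R by rewrite ltr0n.
have c0 : 0 < c by exact: lt_le_trans c1.
have invE (s : R) : 0 <= s ->
    a + g / c + - (g / (c ^+ 2 * i%:R)) / (1 + (c * i%:R)^-1 + s) =
    a + g / (c + (i%:R * (1 + s))^-1).
  move=> s0; field.
  have s1 : 0 < 1 + s by rewrite ltr_wpDr.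
  have d0 : 0 < c * (i%:R * (1 + s)) + 1.
    by rewrite addr_gt0// !mulr_gt0.
  by rewrite !gt_eqF.
have stepP (s : R) : 0 < s < i%:R^-1 ->
    [/\ 0 < (i%:R * (1 + s))^-1 < m%:R^-1,
       ecf_digit1 (i%:R * (1 + s))^-1 = i & ecf_map (i%:R * (1 + s))^-1 = s].
  move=> /andP[s0 si]; have s0i : 0 <= s < i%:R^-1 by rewrite ltW.
  have [dE mE] := ecf_map_branch i0 s0i; split=> //.
  have is0 : 0 < i%:R * (1 + s) by rewrite mulr_gt0// addr_gt0.
  rewrite invr_gt0 is0 ltf_pV2 ?posrE ?ltr0n//=.
  by apply: (@le_lt_trans _ _ i%:R); [rewrite ler_nat | rewrite ltr_pMr// ltrDl].
split.
- by apply: measurableI => //; exact: measurable_ecf_digit_eq.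
- by move=> x [/W01].
- by rewrite oppr_eq0 !mulf_neq0// invr_neq0// mulf_neq0// ?gt_eqF// exprn_gt0.
- by rewrite lerDl invr_ge0 mulr_ge0// ltW.
- by move=> x [].
- by move=> x [_ /(ecf_map_digit i0)[]].
- move=> x [Wx /(ecf_map_digit i0)[/andP[s0 _] tE]].
  by rewrite iterS invE// -tE; exact: xW.
- move=> s si; have [tm dE _] := stepP s si; case/andP: si => s0 _.
  rewrite invE ?(ltW s0)//; split; first exact: WE.
  by rewrite /= /ecf_digit/= iterE.
- move=> s si; have [tm _ sE] := stepP s si; case/andP: si => s0 _.
  by rewrite invE ?(ltW s0)// iterS iterE.
Qed.

(** After a digit 0 the ECF map divides by 0, hence lands on its fixed point 0,
    all of whose digits are 0. *)
Lemma ecf_digit_eq0 (R : realType) (n l : nat) (x : measurableTypeR R) :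
  (l <= n)%N -> ecf_digit l.+1 x = 0%N -> ecf_digit n.+1 x = 0%N.
Proof.
elim: n => [|n IHn]; first by rewrite leqn0 => /eqP->.
rewrite leq_eqVlt => /predU1P[->//|/IHn{}IHn /IHn].
rewrite /ecf_digit/= => n0.
by rewrite {1}/ecf_map n0 /ecf_digit1 invr0 !mulr0 mul0r invr0 mulr0 truncn0.
Qed.

(** * From branches to the events b_n = j *)

(** Comparing the measures of two parts of the event b_n = j can be done on each
    branch of rank n with last digit j.  The inequality is shown inside every
    branch of rank l <= n, by induction on d = n - l: a branch is cut according
    to its next digit.  Pieces that are not branches of rank l + 1 have next
    digit 0, in which case b_n = 0 <> j, or a next digit in [1, m[, which
    contradicts T^l x < 1 / m. *)
Lemma ecf_branch_le (R : realType) (n j : nat)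
    (A B : set (measurableTypeR R)) (r s : R) :
  (0 < n)%N -> (0 < j)%N -> 0 <= r -> 0 <= s ->
  measurable A -> measurable B ->
  A `<=` [set x | ecf_digit n x = j] -> B `<=` [set x | ecf_digit n x = j] ->
  (forall W a g c, ecf_branch n j W a g c ->
    (r%:E * leb01 (W `&` A) <= s%:E * leb01 (W `&` B))%E) ->
  (r%:E * leb01 A <= s%:E * leb01 B)%E.
Proof.
move=> n0 j0 r0 s0 mA mB Aj Bj branch_le.
have split0 (D : set (measurableTypeR R)) :
    D `&` A = set0 -> (r%:E * leb01 (D `&` A) <= s%:E * leb01 (D `&` B))%E.
  by move=> ->; rewrite measure0 mule0 mule_ge0// measure_ge0.
have digit0 l (x : measurableTypeR R) : (l < n)%N ->
    ecf_digit n x = j -> ecf_digit l.+1 x != 0%N.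
  move=> ln xj; apply/eqP => /(@ecf_digit_eq0 _ n.-1).
  by rewrite prednK// xj -ltnS prednK// => /(_ ln) jE; rewrite jE in j0.
have refine d : forall l m W a g c, (l + d = n)%N -> (0 < m)%N ->
    ecf_branch l m W a g c ->
    (r%:E * leb01 (W `&` A) <= s%:E * leb01 (W `&` B))%E.
  elim: d => [|d IHd] l m W a g c ldn m0 Wb.
    have {ldn}ln : l = n by rewrite -ldn addn0.
    move: Wb; rewrite ln => Wb; have [mj|mj] := eqVneq m j.
      by apply: branch_le; rewrite -mj; exact: Wb.
    apply: split0; rewrite -subset0 => x [/(branch_digit Wb) xm /Aj /= xj].
    by move: mj; rewrite -xm xj eqxx.
  have mW := branch_measurable Wb.
  apply: (measure_partition_le (@measurable_ecf_digit R l.+1)) => //.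
  - exact: measurableI.
  - exact: measurableI.
  - move=> i; rewrite (setIAC W A) (setIAC W B).
    have [mi|im] := leqP m i.
      by apply: (IHd l.+1 i); [rewrite addSnnS | exact: leq_trans mi |
                               exact: ecf_branchS Wb].
    apply: split0; rewrite -subset0 => x [[Wx xi] /Aj xj].
    have i0 : (0 < i)%N.
      by rewrite lt0n -xi; apply: digit0 xj; rewrite -ldn -addSnnS leq_addr.
    have /andP[_ xm] := branch_orbit Wb Wx.
    have /andP[ix _] := (ecf_digit1P _ i0).1 xi.
    have := lt_trans ix xm; rewrite ltf_pV2 ?posrE ?ltr0n// ltr_nat.
    by rewrite ltnNge im.
apply: (measure_partition_le (@measurable_ecf_digit R 1)) => // i.
rewrite !(setIC _ [set x | ecf_digit 1 x = i]).
have [->|i0] := posnP i.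
  by apply: split0; rewrite -subset0 => x [/eqP x0 /Aj /(digit0 _ _ n0)/negP].
by apply: (refine n.-1 1 i); [rewrite add1n prednK | | exact: ecf_branch1].
Qed.

(** The outer factor is the proportion claimed by the theorem, the middle term
    and the factor on its sides are, up to |g|, the lengths of the part
    b_(n+1) = k of a branch and of the whole branch with last digit j. *)
Lemma branch_ratio_bounds (R : realFieldType) (j k c : R) :
  1 <= j -> j <= k -> 1 <= c ->
  j / (k * (k + 2)) * (j^-1 / (c * (c + j^-1)))
    <= (k^-1 - (k + 1)^-1) / ((c + (k + 1)^-1) * (c + k^-1))
    <= (j + 1) / (k * (k + 1)) * (j^-1 / (c * (c + j^-1))).
Proof.
move=> j1 jk c1.
have j0 : 0 < j by lra.
have k0 : 0 < k by lra.
have c0 : 0 < c by lra.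
have cj : 0 < c * j + 1 by rewrite addr_gt0// mulr_gt0.
have ck : 0 < c * k + 1 by rewrite addr_gt0// mulr_gt0.
have ck1 : 0 < c * (k + 1) + 1 by rewrite addr_gt0// mulr_gt0// addr_gt0.
have -> : j^-1 / (c * (c + j^-1)) = (c * (c * j + 1))^-1.
  by field; rewrite !gt_eqF.
have -> : (k^-1 - (k + 1)^-1) / ((c + (k + 1)^-1) * (c + k^-1)) =
    ((c * (k + 1) + 1) * (c * k + 1))^-1.
  by field; rewrite !gt_eqF// addr_gt0.
have kk p : 0 < p -> 0 < k * (k + p) * (c * (c * j + 1)).
  by move=> p0; rewrite !mulr_gt0// addr_gt0.
have cross (x y z : R) : 0 < y -> 0 < z -> (x / y <= z^-1) = (x * z <= y).
  by move=> y0 z0; rewrite ler_pdivrMr// mulrC ler_pdivlMr.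
have cross' (x y z : R) : 0 < y -> 0 < z -> (z^-1 <= x / y) = (y <= x * z).
  by move=> y0 z0; rewrite ler_pdivlMr// mulrC ler_pdivrMr.
have ckk : 0 < (c * (k + 1) + 1) * (c * k + 1) by exact: mulr_gt0.
rewrite -!mulrA -!invfM cross ?cross' ?kk//.
have jk0 : 0 <= k - j by rewrite subr_ge0.
have c10 : 0 <= c - 1 by rewrite subr_ge0.
have [j0' k0' c0'] : [/\ 0 <= j, 0 <= k & 0 <= c] by split; exact: ltW.
(* With the denominators cleared, each difference expands into nonnegative
   products of j, k, k - j, c and c - 1. *)
apply/andP; split; rewrite -subr_ge0.
- rewrite [leRHS](_ : _ = c * (c - 1) * j ^+ 2 + c ^+ 2 * j * (k - j)
      + c * (k - j) ^+ 2 + 2 * c * (k - j) + (c - 1) * j); last by ring.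
  by do ?[done | exact: sqr_ge0 | apply: mulr_ge0 | apply: addr_ge0].
- rewrite [leRHS](_ : _ = c * (c - 1) * k * (k + 1)
      + (j + 1) * (c * (2 * k + 1) + 1)); last by ring.
  by do ?[done | apply: mulr_ge0 | apply: addr_ge0].
Qed.

(** The witness is the branch with n digits all equal to j. *)
Lemma leb01_digit_gt0 (R : realType) (n j : nat) : (0 < n)%N -> (0 < j)%N ->
  (0 < leb01 [set x : measurableTypeR R | ecf_digit n x = j])%E.
Proof.
move=> n0 j0.
have [W [a [g [c Wb]]]] : exists W a g c, @ecf_branch R n j W a g c.
  elim: n n0 => // -[_ _|n IHn _].
    by do 4 eexists; exact: ecf_branch1.
  have [//|W [a [g [c Wb]]]] := IHn.
  by do 4 eexists; exact: ecf_branchS Wb.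
have mW := branch_measurable Wb; have c1 := branch_ge1 Wb.
have W0 : (0 < leb01 W)%E.
  have jV0 : 0 < j%:R^-1 :> R by rewrite invr_gt0 ltr0n.
  have c0 : 0 < c by exact: lt_le_trans c1.
  rewrite (leb01_branchT Wb) lte_fin mulr_gt0 ?normr_gt0 ?(branch_neq0 Wb)//.
  by rewrite divr_gt0// mulr_gt0// addr_gt0.
apply: (lt_le_trans W0); apply: le_measure; rewrite ?inE//.
  exact: measurable_ecf_digit_eq.
exact: branch_digit Wb.
Qed.

Theorem proposition3p4 (R : realType) (j k : nat)
    (hj : (1 <= j)%N) (hjk : (j <= k)%N) :
  leb01 [set x | @ecf_digit R 1 x = j] = (1 / (j%:R * (j%:R + 1)))%:E /\
  (forall n : nat, (1 <= n)%N ->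
    j%:R / (k%:R * (k%:R + 2))
      <= cond_prob (@leb01 R) [set x | @ecf_digit R n.+1 x = k]
                              [set x | @ecf_digit R n x = j]
      <= (j%:R + 1) / (k%:R * (k%:R + 1))).
Proof.
have hk : (1 <= k)%N by exact: leq_trans hjk.
have j1 : 1 <= j%:R :> R by rewrite ler1n.
have jkR : j%:R <= k%:R :> R by rewrite ler_nat.
split.
  rewrite (leb01_branchT (ecf_branch1 R hj)) ger0_norm ?invr_ge0//.
  by congr (_%:E); field; rewrite !gt_eqF//; nra.
move=> n n1.
set A := [set x | ecf_digit n.+1 x = k]; set B := [set x | ecf_digit n x = j].
have mA : measurable A by exact: measurable_ecf_digit_eq.
have mB : measurable B by exact: measurable_ecf_digit_eq.
have WB W a g c : ecf_branch n j W a g c -> W `&` B = W.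
  by move=> Wb; apply: setIidl; exact: branch_digit Wb.
have leb01WAB W a g c : ecf_branch n j W a g c -> leb01 (W `&` (A `&` B)) =
    (`|g| * ((k%:R^-1 - (k%:R + 1)^-1) /
       ((c + (k%:R + 1)^-1) * (c + k%:R^-1))))%:E.
  move=> Wb.
  have AP x : A x <-> k.+1%:R^-1 < iter n (@ecf_map R) x <= k%:R^-1.
    exact: ecf_digit1P.
  rewrite setICA (WB _ _ _ _ Wb) setIC.
  have mWA : measurable (W `&` A).
    by apply: measurableI => //; exact: branch_measurable Wb.
  have [k0R k1R] : 0 < k%:R :> R /\ 0 < k.+1%:R :> R by rewrite !ltr0n.
  rewrite natr1 mulrA (leb01_branch (u := k.+1%:R^-1) (v := k%:R^-1) Wb _ _ _ mWA)//.
  - by rewrite lef_pV2 ?posrE// ler_nat.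
  - by rewrite lef_pV2 ?posrE ?ltr0n// ler_nat.
  - by move=> x Wx /andP[lo hi]; split=> //; apply/AP; rewrite lo ltW.
  - by move=> x [_ /AP/andP[lo hi]]; rewrite ltW.
have BB : A `&` B `<=` B by exact: subIsetr.
have AB := measurableI _ _ mA mB.
apply: cond_prob_bounds => //; first exact: leb01_digit_gt0.
  rewrite -[leRHS]mul1e; apply: (ecf_branch_le n1 hj) => //.
  move=> W a g c Wb; have /andP[lo _] := branch_ratio_bounds j1 jkR (branch_ge1 Wb).
  rewrite mul1e (leb01WAB _ _ _ _ Wb) (WB _ _ _ _ Wb) (leb01_branchT Wb).
  by rewrite -EFinM lee_fin mulrCA ler_wpM2l.
rewrite -[leLHS]mul1e; apply: (ecf_branch_le n1 hj) => //.
move=> W a g c Wb; have /andP[_ hi] := branch_ratio_bounds j1 jkR (branch_ge1 Wb).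
rewrite mul1e (leb01WAB _ _ _ _ Wb) (WB _ _ _ _ Wb) (leb01_branchT Wb).
by rewrite -EFinM lee_fin [leRHS]mulrCA ler_wpM2l.
Qed.
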